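(* Let $r\geq 2$ be an integer and let $m,n$ be integers. If $G$ is an $(X,Y)$-bipartite graph with $m=|X|\leq |Y|=n$, $\delta(X,Y) > \left( 1 - \frac{(m/n)^3}{128r^5}\right) n$ and $\delta(Y,X) > \left( 1 - \frac{(m/n)^3}{128r^5}\right) m$, then in every $r$-edge coloring of $G$ there exists a monochromatic component on at least $\frac{m+n}{r}$ vertices.
   Context: For an $(X,Y)$-bipartite graph $G$, $\delta(X,Y)$ denotes the minimum degree of a vertex of $X$ (into $Y$), and $\delta(Y,X)$ the minimum degree of a vertex of $Y$ (into $X$). In an edge-colored graph, a monochromatic component is a connected component of the subgraph formed by the edges of a single color. *)

(* Defs.v *)
From mathcomp Require Import all_boot all_order all_algebra.

Set Implicit Arguments.
Unset Strict Implicit.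
Unset Printing Implicit Defensive.

Section Graphs.

Variable V : finType.

Definition simple_graph (e : rel V) : Prop := symmetric e /\ irreflexive e.

Definition bipartite (X Y : {set V}) (e : rel V) : Prop :=
  [/\ [disjoint X & Y],
      X :|: Y = [set: V] &
      forall x y, e x y ->
        (x \in X) && (y \in Y) || (x \in Y) && (y \in X)].

Definition degree_in (e : rel V) (x : V) (B : {set V}) : nat :=
  #|[set y in B | e x y]|.

(* Every degree into B is at most #|B|, so the unit #|B| of the iterated
   minimum only matters when A is empty. *)
Definition min_degree (e : rel V) (A B : {set V}) : nat :=
  \big[minn/#|B|]_(x in A) degree_in e x B.

(* The edge between x and y is the set [set x; y]; a coloring is a function on
   all of {set V}, of which only the values on edges are ever used. *)
Definition edge_coloring (r : nat) := {set V} -> 'I_r.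

Definition color_class (e : rel V) (r : nat) (c : edge_coloring r) (i : 'I_r) :
  rel V := fun x y => e x y && (c [set x; y] == i).

(* The vertices of the subgraph formed by the edges of color i are the ends of
   those edges, so a vertex on no edge of color i is not a component. *)
Definition mono_component (e : rel V) (r : nat) (c : edge_coloring r)
    (i : 'I_r) (C : {set V}) : Prop :=
  exists x y : V, color_class e c i x y /\
    C = [set z | connect (color_class e c i) x z].

End Graphs.

(* Main.v *)
Require Import Defs.
From mathcomp Require Import all_boot all_order all_algebra.
From mathcomp Require Import zify ring lra.
Import Order.TTheory GRing.Theory Num.Theory.
Local Open Scope ring_scope.

(** Suppose every monochromatic component has fewer than [(m + n) / r] vertices.
    For each color let [F] be the proportion of pairs of [X * Y] lying in a
    common component. Summing component sizes over such pairs bounds, by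
    Cauchy-Schwarz, [F] above by [1 / r]; as almost all pairs are edges, [F] is
    then nearly [1 / r] for every color, and the deficit in Cauchy-Schwarz shows
    that each component either contains nearly a proportion [1 / r] of both [X]
    and [Y], or a tiny proportion of both. A vertex in a tiny component of one
    color would have too small a degree, so all components are of the first
    kind. Hence a color has at most [r] components, each with fewer than
    [(m + n) / r] vertices, and they cannot cover all the vertices. *)

(** * Density of related pairs and the deficit in Cauchy-Schwarz *)

Section Equivalence.

Variables (K : realFieldType) (V : finType) (R : rel V).
Hypotheses (Rsym : symmetric R) (Rtrans : transitive R).

Definition class_size (A : {set V}) (v : V) : K := #|[set z in A | R v z]|%:R.

Lemma class_sizeE A v : class_size A v = \sum_(z in A) (R v z)%:R.
Proof.
rewrite /class_size -sum1_card natr_sum big_mkcond [RHS]big_mkcond /=.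
by apply: eq_bigr => z _; rewrite inE; case: (z \in A); case: (R v z).
Qed.

Lemma class_size_ge0 A v : 0 <= class_size A v.
Proof. exact: ler0n. Qed.

Lemma class_size_eq A v w : R v w -> class_size A v = class_size A w.
Proof.
move=> vw; rewrite !class_sizeE; apply: eq_bigr => z _; congr (_%:R).
congr nat_of_bool.
by apply/idP/idP; apply: Rtrans; rewrite // Rsym.
Qed.

(** Both sides sum [g] over the related pairs of [A * B]; since [g] is constant on classes, the
    weight may be read at either end of a pair. *)
Lemma sum_class_size_swap (A B : {set V}) (g : V -> K) :
  (forall v w, R v w -> g v = g w) ->
  \sum_(u in A) g u * class_size B u = \sum_(v in B) g v * class_size A v.
Proof.
move=> gR.
under eq_bigr do rewrite class_sizeE mulr_sumr.
under [RHS]eq_bigr do rewrite class_sizeE mulr_sumr.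
rewrite exchange_big; apply: eq_bigr => v _; apply: eq_bigr => u _.
by rewrite Rsym; have [/gR ->|] := boolP (R v u); rewrite ?mulr0.
Qed.

Lemma class_part_le_sum (A : {set V}) (f : V -> K) w :
  (forall v, 0 <= f v) -> (forall v, R w v -> f v = f w) ->
  class_size A w * f w <= \sum_(v in A) f v.
Proof.
move=> f0 fR; rewrite class_sizeE mulr_suml; apply: ler_sum => v _.
by have [/fR ->|_] := boolP (R w v); rewrite ?mul1r ?mul0r.
Qed.

Variables (X Y : {set V}) (S : K).
Hypothesis class_le : forall v, class_size X v + class_size Y v <= S.

Definition pair_density : K :=
  (\sum_(v in Y) class_size X v) / (#|X|%:R * #|Y|%:R).

Local Notation m := (#|X|%:R : K).
Local Notation n := (#|Y|%:R : K).
Local Notation F := pair_density.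

Hypotheses (m0 : 0 < m) (n0 : 0 < n).

Lemma sum_sqr_deviation (A : {set V}) (f : V -> K) (k : K) :
  \sum_(v in A) (f v - k) ^+ 2 =
  \sum_(v in A) f v * f v - 2 * k * \sum_(v in A) f v + k ^+ 2 * #|A|%:R.
Proof.
rewrite mulr_sumr -sumrB -[#|A|]sum1_card natr_sum mulr_sumr -big_split /=.
by apply: eq_bigr => v _; ring.
Qed.

(* The squared class sizes on both sides add up to the sum of
   [class_size X + class_size Y] over related pairs of [X * Y], hence to at
   most [S] times the number of such pairs. *)
Lemma deviation_le :
  \sum_(v in Y) (class_size X v - F * m) ^+ 2 +
  \sum_(u in X) (class_size Y u - F * n) ^+ 2 <=
  m * n * F * (S - (m + n) * F).
Proof.
have EY : \sum_(v in Y) class_size X v = F * (m * n).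
  by rewrite /F divfK // mulf_neq0 // gt_eqF.
have EX : \sum_(u in X) class_size Y u = F * (m * n).
  rewrite -EY; have := @sum_class_size_swap X Y (fun _ => 1) (fun _ _ _ => erefl).
  by under eq_bigr do rewrite mul1r; under [X in _ = X]eq_bigr do rewrite mul1r.
have sq : \sum_(v in Y) class_size X v * class_size X v +
    \sum_(u in X) class_size Y u * class_size Y u <= S * (F * (m * n)).
  rewrite (@sum_class_size_swap X Y) => [|v w]; last exact: class_size_eq.
  rewrite -EY -big_split mulr_sumr; apply: ler_sum => v _ /=.
  by rewrite -mulrDl ler_wpM2r ?class_size_ge0.
rewrite !sum_sqr_deviation EX EY; lra.
Qed.

(** Among the squares in [deviation_le], only those of vertices in the class of [w] are kept; they
    are all equal on each side. *)
Lemma class_deviation_le w :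
  class_size Y w * (class_size X w - F * m) ^+ 2 +
  class_size X w * (class_size Y w - F * n) ^+ 2 <=
  m * n * F * (S - (m + n) * F).
Proof.
apply: le_trans deviation_le; apply: lerD.
  apply: (@class_part_le_sum Y (fun v => (class_size X v - F * m) ^+ 2)).
    by move=> v; exact: sqr_ge0.
  by move=> v wv; rewrite (class_size_eq X _ _ wv).
apply: (@class_part_le_sum X (fun v => (class_size Y v - F * n) ^+ 2)).
  by move=> v; exact: sqr_ge0.
by move=> v wv; rewrite (class_size_eq Y _ _ wv).
Qed.

(** The bound in [deviation_le] dominates a sum of squares, hence is nonnegative. If [F * (m + n)]
    exceeded [S >= 0], then [F] would be positive and that bound negative. *)
Lemma pair_density_le : F * (m + n) <= S.
Proof.
have dev0 : 0 <= m * n * F * (S - (m + n) * F).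
  apply: le_trans deviation_le; apply: addr_ge0;
    by apply: sumr_ge0 => v _; exact: sqr_ge0.
have S0 : 0 <= S.
  have [v _] : exists v, v \in X by apply/card_gt0P; rewrite -(ltr0n K).
  by apply: le_trans (class_le v); rewrite addr_ge0 ?class_size_ge0.
rewrite leNgt; apply/negP => lt.
have mn0 : 0 < m * n by exact: mulr_gt0.
have mn1 : 0 < m + n by exact: addr_gt0.
have F0 : 0 < F.
  rewrite -(pmulr_lgt0 _ mn1); exact: le_lt_trans S0 lt.
have : m * n * F * (S - (m + n) * F) < 0.
  by rewrite (pmulr_rlt0 _ (mulr_gt0 mn0 F0)) subr_lt0 mulrC.
by rewrite ltNge dev0.
Qed.

End Equivalence.

(** * Estimates on normalized class sizes, and a count of classes *)

Lemma near_or_tiny (K : realFieldType) (a b h F : K) :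
  0 < h -> h <= 1 / 2 -> 0 <= a -> 0 <= b -> 15 / 16 * h <= F ->
  b * (a - F) ^+ 2 <= h ^+ 6 / 64 -> a * (b - F) ^+ 2 <= h ^+ 6 / 64 ->
  (`|a - F| <= h ^+ 2 / 7 /\ `|b - F| <= h ^+ 2 / 7) \/
  (a <= h ^+ 3 / 16 /\ b <= h ^+ 3 / 16).
Proof.
move=> h0 h12.
(* A weight [y] of at least [F / 2] forces the other size [x] close to [F]. *)
have near (x y : K) : 15 / 16 * h <= F -> F / 2 <= y ->
    y * (x - F) ^+ 2 <= h ^+ 6 / 64 -> `|x - F| <= h ^+ 2 / 7.
  move=> hF hy H.
  have H1 : 15 / 32 * h * (x - F) ^+ 2 <= h ^+ 6 / 64.
    by apply: le_trans H; rewrite ler_wpM2r ?sqr_ge0 //; lra.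
  have H2 : (x - F) ^+ 2 <= h ^+ 5 / 30.
    rewrite -(ler_pM2l h0); have -> : h * (h ^+ 5 / 30) = h ^+ 6 / 30 by ring.
    by lra.
  have H3 : h ^+ 5 <= h ^+ 4 / 2.
    by rewrite (exprSr h 4) ler_wpM2l ?exprn_ge0 ?(ltW h0) //; lra.
  have h4 : 0 <= h ^+ 4 by rewrite exprn_ge0 ?ltW.
  rewrite -(@ler_pXn2r _ 2) ?nnegrE ?normr_ge0 //; last first.
    by rewrite divr_ge0 ?exprn_ge0 ?ltW.
  rewrite real_normK ?num_real //.
  have -> : (h ^+ 2 / 7) ^+ 2 = h ^+ 4 / 49 by field.
  by lra.
(* A size [x] below [F / 2] deviates from [F] by at least [15 / 32 * h], so its weight [y] must be
   tiny. *)
have tiny (x y : K) : 15 / 16 * h <= F -> 0 <= y -> x < F / 2 ->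
    y * (x - F) ^+ 2 <= h ^+ 6 / 64 -> y <= h ^+ 3 / 16.
  move=> hF y0 hx H.
  have H0 : (15 / 32 * h) ^+ 2 <= (x - F) ^+ 2.
    rewrite -[leRHS]sqrrN ler_pXn2r ?nnegrE //; lra.
  have H1 : y * (15 / 32 * h) ^+ 2 <= h ^+ 6 / 64.
    by apply: le_trans H; rewrite ler_wpM2l.
  have h2 : 0 < h ^+ 2 by rewrite exprn_gt0.
  have h3 : 0 < h ^+ 3 by rewrite exprn_gt0.
  have H2 : y <= h ^+ 4 * (16 / 225).
    rewrite -(ler_pM2r h2).
    have -> : h ^+ 4 * (16 / 225) * h ^+ 2 = h ^+ 6 / 64 * (32 / 15) ^+ 2.
      by field.
    have -> : y * h ^+ 2 = y * (15 / 32 * h) ^+ 2 * (32 / 15) ^+ 2 by field.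
    by rewrite ler_wpM2r // sqr_ge0.
  have H3 : h ^+ 4 <= h ^+ 3 / 2.
    by rewrite (exprSr h 3) ler_wpM2l ?exprn_ge0 ?(ltW h0) //; lra.
  by lra.
have h3 : h ^+ 3 <= h / 4.
  have : h ^+ 2 <= 1 / 4 by rewrite expr2; nra.
  by rewrite (exprS h 2); nra.
move=> a0 b0 hF Ha Hb.
have [a2|a2] := lerP (F / 2) a; have [b2|b2] := lerP (F / 2) b.
- by left; split; [apply: near Ha | apply: near Hb].
(* Mixed cases are impossible: the size that is at least [F / 2] would be at most
   [h ^+ 3 / 16 <= h / 64]. *)
- have ta := tiny _ _ hF a0 b2 Hb; lra.
- have tb := tiny _ _ hF b0 a2 Ha; lra.
- by right; split; [apply: tiny Hb | apply: tiny Ha].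
Qed.

Lemma normalized_deviation_bounds (K : realFieldType) (m n a b h F eps : K) :
  0 < m -> m <= n -> 0 < h -> h <= 1 / 2 -> 0 <= a -> 0 <= b ->
  eps = (m / n) ^+ 3 * h ^+ 5 / 128 -> h - eps <= F -> F <= h ->
  m * b * (a - F) ^+ 2 + n * a * (b - F) ^+ 2 <= F * (m + n) * (h - F) ->
  b * (a - F) ^+ 2 <= h ^+ 6 / 64 /\ a * (b - F) ^+ 2 <= h ^+ 6 / 64.
Proof.
move=> m0 mn h0 h12 a0 b0 Eeps Fge Fle dev.
have n0 : 0 < n by exact: lt_le_trans mn.
have q0 : 0 < m / n by exact: divr_gt0.
have q1 : m / n <= 1 by rewrite ler_pdivrMr // mul1r.
have q3 : (m / n) ^+ 3 <= m / n by rewrite ler_iXnr // ltW.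
have h5 : 0 < h ^+ 5 by exact: exprn_gt0.
have epsle : eps <= m / n * (h ^+ 5 / 128).
  by rewrite Eeps -mulrA ler_wpM2r // divr_ge0 // ltW.
have epsle1 : eps <= h ^+ 5 / 128.
  apply: le_trans epsle _; rewrite ger_pMl //; lra.
have eps0 : 0 <= eps by rewrite Eeps divr_ge0 // mulr_ge0 // exprn_ge0 // ltW.
(* The first bound comes from dividing [dev] by [m], although its right side is of order [n]; a
   factor [m / n] of [eps] makes up for this. *)
have neps : n * eps <= m * (h ^+ 5 / 128).
  apply: (le_trans (ler_wpM2l (ltW n0) epsle)).
  have nq : n * (m / n) = m by rewrite mulrC divfK ?gt_eqF.
  by rewrite [n * _]mulrA nq.
(* The factor 2, from [m + n <= 2 * n], turns the 128 of [eps] into 64. *)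
have up : F * (m + n) * (h - F) <= h * (2 * n) * eps.
  have F0 : 0 <= F.
    have : h ^+ 5 / 128 <= h; last by lra.
    have h4 : h ^+ 4 <= 1 by rewrite exprn_ile1 //; lra.
    have := ler_wpM2l (ltW h0) h4; rewrite -exprS mulr1; lra.
  apply: ler_pM; rewrite ?mulr_ge0 ?subr_ge0 //; try lra.
  by apply: ler_pM => //; lra.
have d1 : 0 <= m * b * (a - F) ^+ 2 := mulr_ge0 (mulr_ge0 (ltW m0) b0) (sqr_ge0 _).
have d2 : 0 <= n * a * (b - F) ^+ 2 := mulr_ge0 (mulr_ge0 (ltW n0) a0) (sqr_ge0 _).
split.
  rewrite -(ler_pM2l m0).
  have := ler_wpM2l (ltW h0) neps.
  have -> : h * (m * (h ^+ 5 / 128)) = m * (h ^+ 6 / 64) / 2 by field.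
  by lra.
rewrite -(ler_pM2l n0).
have := ler_wpM2l (ltW (mulr_gt0 h0 n0)) epsle1.
have -> : h * n * (h ^+ 5 / 128) = n * (h ^+ 6 / 64) / 2 by field.
by lra.
Qed.

(** Classes larger than [#|V| / (r + 1)] number at most [r]; classes smaller than [#|V| / r] number
    more than [r]. *)
Lemma class_count_contra (V : finType) (R : rel V) (r : nat) :
  equivalence_rel R -> (0 < #|V|)%N ->
  (forall v, #|V| < r.+1 * #|[set z | R v z]|)%N ->
  (forall v, r * #|[set z | R v z]| < #|V|)%N -> False.
Proof.
move=> eqR V0 big small.
have Rin : {in [set: V] & &, equivalence_rel R} by move=> x y z _ _ _; exact: eqR.
have partP := equivalence_partitionP Rin.
set P := equivalence_partition R [set: V] in partP.
have cls A : A \in P -> exists v, A = [set z | R v z].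
  by case/imsetP => v _ ->; exists v; apply/setP => z; rewrite !inE.
have sumP := card_partition partP; rewrite cardsT in sumP.
(* The additional [#|P|], here and in [hi], records the strictness of the bound, one unit per
   class. *)
have lo : (#|P| * #|V| + #|P| <= r.+1 * #|V|)%N.
  rewrite [in X in (_ <= X)%N]sumP big_distrr /= addnC -mulnS -sum_nat_const.
  by apply: leq_sum => A /cls[v ->].
have hi : (r * #|V| + #|P| <= #|P| * #|V|)%N.
  rewrite [in X in (X + _ <= _)%N]sumP big_distrr /=.
  rewrite -[X in (_ + X <= _)%N]sum1_card -big_split /= -sum_nat_const.
  by apply: leq_sum => A /cls[v ->]; rewrite addn1.
have P0 : (0 < #|P|)%N.
  by rewrite lt0n; apply: contraTneq V0 => /cards0_eq P0; rewrite sumP P0 big_set0.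
by have [le|lt] := leqP #|P| r; [have := leq_mul le (leqnn #|V|)
                                | have := leq_mul lt (leqnn #|V|)]; lia.
Qed.

Lemma natr_pred_div (K : realFieldType) (r : nat) :
  (0 < r)%N -> r.-1%:R / r%:R = 1 - r%:R^-1 :> K.
Proof.
case: r => // k _.
by rewrite -[k.+1.-1%:R](addrK 1) natr1 mulrBl divff ?pnatr_eq0 // mul1r.
Qed.

(** For [h = 1 / r], a class that is not tiny covers a proportion above [h / (1 + h) = 1 / (r + 1)],
    as the count of classes requires. *)
Lemma near_class_factor_gt (K : realFieldType) (h e : K) :
  0 < h -> h <= 1 / 2 -> e <= h ^+ 2 / 1024 ->
  h < (h - e - h ^+ 2 / 7) * (1 + h).
Proof.
move=> h0 h12 he.
have h2 : 0 < h ^+ 2 by exact: exprn_gt0.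
have h3 : h ^+ 3 <= h ^+ 2 / 2.
  by rewrite (exprSr h 2) ler_wpM2l ?(ltW h2) //; lra.
have h1 : 0 <= 1 + h by lra.
have := ler_wpM2l h1 he; lra.
Qed.

(** * A large class among [r] equivalence relations *)

Section LargeClass.

Variables (K : realFieldType) (V : finType) (r : nat) (R : 'I_r -> rel V) (X Y : {set V}).
Hypotheses (r2 : (2 <= r)%N) (XY : Y = ~: X) (XleY : (#|X| <= #|Y|)%N).
Hypotheses (Rrefl : forall i, reflexive (R i)) (Rsym : forall i, symmetric (R i)).
Hypothesis Rtrans : forall i, transitive (R i).

Local Notation m := (#|X|%:R : K).
Local Notation n := (#|Y|%:R : K).
Local Notation h := (r%:R^-1 : K).
Local Notation eps := ((m / n) ^+ 3 * h ^+ 5 / 128).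

Hypothesis X0 : (0 < #|X|)%N.
Hypothesis degY :
  forall v, v \in Y -> (1 - eps) * m < \sum_i class_size K V (R i) X v.
Hypothesis degX :
  forall u, u \in X -> (1 - eps) * n < \sum_i class_size K V (R i) Y u.

Lemma class_size_total i v :
  class_size K V (R i) X v + class_size K V (R i) Y v = #|[set z | R i v z]|%:R.
Proof.
rewrite /class_size -natrD XY; congr (_%:R).
rewrite -(cardsID X [set z | R i v z]); congr (_ + _)%N;
  by apply: eq_card => z; rewrite !inE andbC.
Qed.

(* A vertex in a tiny class of one relation cannot have enough neighbours, as
   the other [r - 1] classes each cover only slightly more than [1 / r]. *)
Lemma tiny_class_contra (A : {set V}) (q e : K) i v :
  0 < q -> e <= h / 2 ->
  (1 - e) * q < \sum_j class_size K V (R j) A v ->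
  (forall j, class_size K V (R j) A v <= (h + h ^+ 2 / 7) * q) ->
  class_size K V (R i) A v <= h ^+ 3 / 16 * q -> False.
Proof.
move=> q0 he deg le tiny.
have h0 : 0 < h by rewrite invr_gt0 ltr0n; lia.
have h12 : h <= 1 / 2.
  by rewrite div1r lef_pV2 ?posrE ?ltr0n ?ler_nat //; lia.
have others : \sum_(j | j != i) class_size K V (R j) A v <=
    (1 - h) * (1 + h / 7) * q.
  apply: (@le_trans _ _ (\sum_(j < r | j != i) (h + h ^+ 2 / 7) * q)).
    by apply: ler_sum => j _.
  rewrite sumr_const cardC1 card_ord -[_ *+ r.-1]mulr_natl mulrA ler_pM2r //.
  have rh : r.-1%:R * h = 1 - h by apply: natr_pred_div; exact: ltnW r2.
  have -> : r.-1%:R * (h + h ^+ 2 / 7) = r.-1%:R * h * (1 + h / 7) by ring.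
  by rewrite rh.
move: deg; rewrite (bigD1 i) //= => deg.
have : (1 - e) * q < (h ^+ 3 / 16 + (1 - h) * (1 + h / 7)) * q.
  by rewrite [ltRHS]mulrDl; apply: lt_le_trans deg _; exact: lerD.
rewrite (ltr_pM2r q0).
have h2 : 0 <= h ^+ 2 by exact: sqr_ge0.
have h3 : h ^+ 3 <= h.
  by rewrite ler_iXnr ?ltW //; lra.
by lra.
Qed.

Lemma exists_large_class :
  exists (i : 'I_r) (v : V), (m + n) / r%:R <= #|[set z | R i v z]|%:R.
Proof.
have [/existsP[i /existsP[v H]]|no] :=
  boolP [exists i, exists v, (m + n) / r%:R <= #|[set z | R i v z]|%:R].
  by exists i, v.
have small i v : #|[set z | R i v z]|%:R < (m + n) * h.
  rewrite ltNge; apply: contra no => H.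
  by apply/existsP; exists i; apply/existsP; exists v.
have cl i v : class_size K V (R i) X v + class_size K V (R i) Y v <= (m + n) * h.
  by rewrite class_size_total ltW.
have m0 : 0 < m by rewrite ltr0n.
have mn : m <= n by rewrite ler_nat.
have n0 : 0 < n by exact: lt_le_trans mn.
have mn0 : 0 < m + n by exact: addr_gt0.
have h0 : 0 < h by rewrite invr_gt0 ltr0n; lia.
have h12 : h <= 1 / 2.
  by rewrite div1r lef_pV2 ?posrE ?ltr0n ?ler_nat //; lia.
have r0 : 0 < r%:R :> K by rewrite ltr0n (ltnW r2).
have rh : r%:R * h = 1 by rewrite divff // pnatr_eq0; lia.
have h2 : 0 <= h ^+ 2 by exact: sqr_ge0.
(* Here [1024 = 8 * 128], with the 8 from [h ^+ 3 <= 1 / 8]. *)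
have eps_le2 : eps <= h ^+ 2 / 1024.
  have q3 : (m / n) ^+ 3 <= 1.
    by rewrite exprn_ile1 ?divr_ge0 ?ler0n // ler_pdivrMr // mul1r.
  have h3 : h ^+ 3 <= 1 / 8.
    have -> : 1 / 8 = (1 / 2) ^+ 3 :> K by field.
    by rewrite ler_pXn2r ?nnegrE ?(ltW h0) //; lra.
  have h5 := ler_wpM2l h2 h3; rewrite -exprD in h5.
  have h50 : 0 <= h ^+ 5 by rewrite exprn_ge0 ?ltW.
  have := ler_wpM2r h50 q3; lra.
have eps_le : eps <= h / 2048.
  by have := ler_wpM2l (ltW h0) h12; rewrite -expr2; lra.
pose F i := pair_density K V (R i) X Y.
have Fle i : F i <= h.
  by rewrite -(ler_pM2r mn0) [leRHS]mulrC; exact: pair_density_le.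
(* This is [degY] averaged over [Y]. *)
have sumF : 1 - eps <= \sum_i F i.
  rewrite /F /pair_density -mulr_suml exchange_big /= ler_pdivlMr ?mulr_gt0 //.
  rewrite mulrA mulr_natr -sumr_const; apply: ler_sum => v vY.
  exact: ltW (degY _ vY).
(* The other [r - 1] densities are at most [h] each, so they total at most [1 - h]. *)
have Fge i : h - eps <= F i.
  have : \sum_(j | j != i) F j <= 1 - h.
    apply: (@le_trans _ _ (\sum_(j < r | j != i) h)).
      by apply: ler_sum => j _.
    rewrite sumr_const cardC1 card_ord -[_ *+ r.-1]mulr_natl.
    by rewrite natr_pred_div // (ltnW r2).
  by move: sumF; rewrite (bigD1 i) //=; lra.
have dich i v : let a := class_size K V (R i) X v / m in
    let b := class_size K V (R i) Y v / n in
    (`|a - F i| <= h ^+ 2 / 7 /\ `|b - F i| <= h ^+ 2 / 7) \/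
    (a <= h ^+ 3 / 16 /\ b <= h ^+ 3 / 16).
  move=> a b.
  have a0 : 0 <= a by rewrite divr_ge0 ?class_size_ge0 ?ltW.
  have b0 : 0 <= b by rewrite divr_ge0 ?class_size_ge0 ?ltW.
  have [|d1 d2] := @normalized_deviation_bounds K m n a b h (F i) eps
    m0 mn h0 h12 a0 b0 erefl (Fge i) (Fle i).
  - have := class_deviation_le K V (R i) (Rsym i) (Rtrans i) X Y _ (cl i) m0 n0 v.
    have -> : class_size K V (R i) X v = a * m by rewrite divfK ?gt_eqF.
    have -> : class_size K V (R i) Y v = b * n by rewrite divfK ?gt_eqF.
    rewrite -/(F i).
    have -> : b * n * (a * m - F i * m) ^+ 2 + a * m * (b * n - F i * n) ^+ 2 =
      m * n * (m * b * (a - F i) ^+ 2 + n * a * (b - F i) ^+ 2) by ring.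
    have -> : m * n * F i * ((m + n) * h - (m + n) * F i) =
      m * n * (F i * (m + n) * (h - F i)) by ring.
    by rewrite ler_pM2l ?mulr_gt0.
  - by apply: near_or_tiny => //; have := Fge i; lra.
have h3 : h ^+ 3 <= h by rewrite ler_iXnr ?ltW //; lra.
have leX j v : class_size K V (R j) X v <= (h + h ^+ 2 / 7) * m.
  rewrite -ler_pdivrMr //; have := Fle j.
  by case: (dich j v) => [[]|[]]; rewrite ?ler_norml; lra.
have leY j v : class_size K V (R j) Y v <= (h + h ^+ 2 / 7) * n.
  rewrite -ler_pdivrMr //; have := Fle j.
  by case: (dich j v) => [[]|[]]; rewrite ?ler_norml; lra.
have near i v : h - eps - h ^+ 2 / 7 <= class_size K V (R i) X v / m /\
    h - eps - h ^+ 2 / 7 <= class_size K V (R i) Y v / n.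
  have := Fge i.
  case: (dich i v) => [[]|[]]; first by rewrite !ler_norml; lra.
  rewrite !ler_pdivrMr // => tX tY; exfalso.
  have eps2 : eps <= h / 2 by lra.
  (* A tiny class is small on both sides; the degree of [v] into the side opposite to its own is
     contradicted. *)
  have [vX|vX] := boolP (v \in X).
    exact: (tiny_class_contra Y n eps i v n0 eps2 (degX _ vX) (leY^~ v) tY).
  have vY : v \in Y by rewrite XY inE.
  exact: (tiny_class_contra X m eps i v m0 eps2 (degY _ vY) (leX^~ v) tX).
(* Every class of every color is now near, so the classes of any single color give the
   contradiction. *)
pose i0 : 'I_r := Ordinal (ltnW r2).
have cardV : #|V|%:R = m + n by rewrite -natrD XY cardsC.
exfalso; apply: (@class_count_contra V (R i0) r).
- move=> x y z; split; first exact: Rrefl.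
  move=> xy; apply/idP/idP; last exact: Rtrans.
  by apply: Rtrans; rewrite Rsym.
- by rewrite -(ltr0n K) cardV.
- move=> v; rewrite -(ltr_nat K) natrM cardV -class_size_total -natr1.
  have [] := near i0 v; rewrite !ler_pdivlMr // => nX nY.
  have big := near_class_factor_gt K h eps h0 h12 eps_le2.
  set x := class_size _ _ _ _ _ in nX *; set y := class_size _ _ _ _ _ in nY *.
  have xy : (m + n) * (h - eps - h ^+ 2 / 7) <= x + y by lra.
  have : (m + n) * h < (x + y) * (1 + h).
    apply: (@lt_le_trans _ _ ((m + n) * ((h - eps - h ^+ 2 / 7) * (1 + h)))).
      by rewrite ltr_pM2l.
    by rewrite mulrA ler_wpM2r //; lra.
  rewrite (ltr_pdivrMr _ _ r0).
  have -> : (x + y) * (1 + h) * r%:R = (x + y) * (r%:R + r%:R * h) by ring.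
  by rewrite rh mulrC.
- move=> v; rewrite -(ltr_nat K) natrM cardV mulrC -ltr_pdivlMr //.
Qed.

End LargeClass.

(** * From classes to monochromatic components of the graph *)

Lemma connect_neq_step (V : finType) (e : rel V) v z :
  connect e v z -> z != v -> exists w, e v w.
Proof.
case/connectP => -[|w p] /=; first by move=> _ ->; rewrite eqxx.
by case/andP => vw _ _ _; exists w.
Qed.

(** Makes the lower bound on degrees nonnegative, so that the strict degree condition yields an
    edge. *)
Lemma error_le1 (K : realFieldType) (m n r : nat) :
  (m <= n)%N -> (0 < n)%N -> (0 < r)%N ->
  (m%:R / n%:R) ^+ 3 * r%:R^-1 ^+ 5 / 128 <= 1 :> K.
Proof.
move=> mn n0 r0.
have q3 : (m%:R / n%:R) ^+ 3 <= 1 :> K.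
  by rewrite exprn_ile1 ?divr_ge0 // ler_pdivrMr ?ltr0n // mul1r ler_nat.
have h5 : r%:R^-1 ^+ 5 <= 1 :> K.
  by rewrite exprn_ile1 ?invr_ge0 // invf_le1 ?ltr0n // ler1n.
have qh : (m%:R / n%:R) ^+ 3 * r%:R^-1 ^+ 5 <= 1 :> K.
  by rewrite mulr_ile1 ?exprn_ge0 ?divr_ge0 ?invr_ge0.
by rewrite ler_pdivrMr //; lra.
Qed.

Lemma min_degree_le (V : finType) (e : rel V) (A B : {set V}) v :
  v \in A -> (min_degree e A B <= degree_in e v B)%N.
Proof.
move=> vA; rewrite /min_degree; have := mem_index_enum v.
elim: (index_enum V) => // a s IHs; rewrite big_cons inE => /orP[/eqP <-|/IHs le].
  by rewrite vA geq_minl.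
by case: ifP => // _; exact: leq_trans (geq_minr _ _) le.
Qed.

(** Each neighbour [z] of [v] is counted at least once, in the class for the color of the edge
    [[set v; z]]. *)
Lemma degree_le_sum_class_size (K : realFieldType) (V : finType) (r : nat)
    (e : rel V) (c : edge_coloring V r) (A : {set V}) v :
  (degree_in e v A)%:R <=
  \sum_i class_size K V (connect (color_class e c i)) A v.
Proof.
rewrite /class_size -natr_sum ler_nat /degree_in -sum1_card.
under [leqRHS]eq_bigr do rewrite -sum1_card big_mkcond /=.
rewrite exchange_big /= big_mkcond /=; apply: leq_sum => z _.
rewrite inE; case: ifP => // /andP[zA evz].
rewrite (bigD1 (c [set v; z])) //= inE zA connect1 //.
by rewrite /color_class evz eqxx.
Qed.

Theorem theorem6 (r m n : nat) (V : finType) (X Y : {set V}) (e : rel V)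
  (hr : (2 <= r)%N)
  (hG : simple_graph e) (hXY : bipartite X Y e)
  (hm : #|X| = m) (hn : #|Y| = n) (hmn : (m <= n)%N)
  (hdX : (min_degree e X Y)%:R >
         (1 - (m%:R / n%:R) ^+ 3 / (128 * r%:R ^+ 5)) * n%:R :> rat)
  (hdY : (min_degree e Y X)%:R >
         (1 - (m%:R / n%:R) ^+ 3 / (128 * r%:R ^+ 5)) * m%:R :> rat)
  (c : edge_coloring V r) :
  exists (i : 'I_r) (C : {set V}),
    mono_component e c i C /\ (m + n)%:R / r%:R <= #|C|%:R :> rat.
Proof.
have [esym _] := hG; have [dXY cXY _] := hXY.
have YE : Y = ~: X.
  apply/setP => z; rewrite inE; have [zX|zX] := boolP (z \in X).
    exact: disjointFr dXY zX.
  by have : z \in X :|: Y by [rewrite cXY inE]; rewrite inE (negbTE zX).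
have degX u : u \in X -> (min_degree e X Y <= degree_in e u Y)%N.
  exact: min_degree_le.
have degY v : v \in Y -> (min_degree e Y X <= degree_in e v X)%N.
  exact: min_degree_le.
(* If [m = 0], then [hdY] makes [min_degree e Y X] positive, whereas degrees into the empty [X]
   vanish, and so does the default [#|X|] for empty [Y]. *)
have m0 : (0 < m)%N.
  rewrite lt0n; apply/negP => /eqP m0; move: hdY.
  rewrite m0 mulr0 ltr0n ltnNge => /negP; apply.
  have [y yY|Y0] := pickP (mem Y).
    apply: leq_trans (degY _ yY) _; rewrite -m0 -hm; apply: subset_leq_card.
    by apply/subsetP => z; rewrite inE => /andP[].
  by rewrite /min_degree big_pred0 // hm m0.
have epsE : (m%:R / n%:R) ^+ 3 / (128 * r%:R ^+ 5) =
    (m%:R / n%:R) ^+ 3 * r%:R^-1 ^+ 5 / 128 :> rat.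
  by rewrite exprVn invfM mulrA mulrAC.
rewrite epsE in hdX hdY.
have csym i : symmetric (color_class e c i).
  by move=> x y; rewrite /color_class esym setUC.
pose R i : rel V := connect (color_class e c i).
have XleY : (#|X| <= #|Y|)%N by rewrite hm hn.
have X0 : (0 < #|X|)%N by rewrite hm.
have [v vY|u uX|i [v large]] := @exists_large_class rat V r R X Y hr YE XleY
    (fun i => @connect0 _ _) (fun i => sym_connect_sym (csym i))
    (fun i => @connect_trans _ _) X0.
- rewrite hm hn; apply: lt_le_trans hdY _.
  apply: le_trans (degree_le_sum_class_size rat V r e c X v).
  by rewrite ler_nat degY.
- rewrite hm hn; apply: lt_le_trans hdX _.
  apply: le_trans (degree_le_sum_class_size rat V r e c Y u).
  by rewrite ler_nat degX.
rewrite hm hn -natrD in large.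
pose D := [set z | R i v z].
have vD : v \in D by rewrite inE; exact: connect0.
have [/existsP[z /andP[zD zv]]|single] := boolP [exists z, (z \in D) && (z != v)].
  have [w vw] : exists w, color_class e c i v w.
    by apply: connect_neq_step zv; rewrite inE in zD.
  by exists i, D; split=> //; exists v, w.
(* A singleton class has no edge of color [i] and is not a component. But then [(m + n) / r <= 1],
   and the component of any edge is large enough. *)
have D1 : D = [set v].
  apply/setP => z; apply/idP/set1P => [zD|-> //].
  by apply: contraNeq single => zv; apply/existsP; exists z; rewrite zD.
have {}large : (m + n)%:R / r%:R <= 1 :> rat by rewrite -/D D1 cards1 in large.
have [u uX] : exists u, u \in X by apply/card_gt0P; rewrite hm.
have [y uy] : exists y, e u y.
  have : (0 < degree_in e u Y)%N.
    apply: leq_trans (degX _ uX); rewrite -(ltr0n rat); apply: le_lt_trans hdX.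
    rewrite mulr_ge0 // subr_ge0; apply: error_le1; lia.
  by case/card_gt0P => y; rewrite inE => /andP[_ ?]; exists y.
exists (c [set u; y]), [set z | connect (color_class e c (c [set u; y])) u z].
split; first by exists u, y; rewrite /color_class uy eqxx.
apply: le_trans large _; rewrite ler1n; apply/card_gt0P; exists u.
by rewrite inE connect0.
Qed.
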